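(* Let $r>1$. For any convex body $V\subset B(0,1)\subset\mathbb{R}^n$ and any $f\in\mathcal{O}_r$ the inequality $$\frac{1}{|V|}\int_V\left|\log\frac{|f|}{\|f\|_V}\right|dx\le C\,d_f(r)\log n$$ holds with an absolute constant $C$, where $\|f\|_V:=\sup_V|f|$.
   Context: $B_c(0,1)\subset B_c(0,r)\subset\mathbb{C}^n$ are the open complex Euclidean balls of radii $1$ and $r$ centered at $0$; $B(0,1)\subset B_c(0,1)$ is the real Euclidean unit ball in $\mathbb{R}^n$; $\mathcal{O}_r$ is the set of holomorphic functions defined on $B_c(0,r)$. A convex body is a bounded convex subset of $\mathbb{R}^n$ with nonempty interior. $|V|$ is the $n$-dimensional Lebesgue measure of $V$ and $dx$ is Lebesgue measure. Chebyshev degree: for any $f\in\mathcal{O}_r$ there is a constant $d=d(f,r)>0$ such that $$\sup_I|f|\le\left(\frac{4|I|}{|\omega|}\right)^{d}\sup_\omega|f|$$ for every real straight line $l_x\subset\mathbb{C}^n(=\mathbb{R}^{2n})$ passing through a point $x\in B_c(0,1)$, every interval $I\subset l_x\cap B_c(0,1)$ and every measurable subset $\omega\subset I$ (here $|I|$ and $|\omega|$ are one-dimensional Lebesgue measures). The best constant $d$ in this inequality is called the Chebyshev degree of $f$ in $B_c(0,1)$ and is denoted by $d_f(r)$.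
   Formalization: The formal theorem assumes n ≥ 2, since for n = 1 the right side is 0 and the claim fails (e.g. f(z) = z on V = (-1/2, 1/2)); it also assumes the supremum of |f| over V is nonzero, so that the quotient is defined. *)

(* Defs.v *)
From HB Require Import structures.
From mathcomp Require Import all_boot all_order all_algebra.
From mathcomp Require Import all_classical all_reals all_analysis.
From mathcomp Require Import complex.

Set Implicit Arguments.
Unset Strict Implicit.
Unset Printing Implicit Defensive.

Import Order.TTheory GRing.Theory Num.Theory.
Import numFieldNormedType.Exports.

Local Open Scope classical_set_scope.
Local Open Scope ring_scope.

Section lebesgue_measure_Rn.
Context (R : realType) (n : nat).

(* [None] is the empty box: it lets a sequence of boxes encode a finite cover
   (closed boxes [a, b] alone would give the wrong value at [set0] for n = 0) *)
Definition box (B : option ('rV[R]_n * 'rV[R]_n)) : set 'rV[R]_n :=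
  if B is Some (a, b) then [set x | forall i, a 0 i <= x 0 i <= b 0 i]
  else set0.

Definition box_volume (B : option ('rV[R]_n * 'rV[R]_n)) : \bar R :=
  if B is Some (a, b) then (\prod_i Num.max 0 (b 0 i - a 0 i))%:E else 0%E.

Definition lebesgue_outer (A : set 'rV[R]_n) : \bar R :=
  ereal_inf [set (\sum_(k <oo) box_volume (F k))%E | F in
    [set F : (option ('rV[R]_n * 'rV[R]_n))^nat |
      A `<=` \bigcup_k box (F k)]].

Local Open Scope ereal_scope.

Lemma box_volume_ge0 B : 0 <= box_volume B.
Proof.
case: B => [[a b]|] //=; rewrite lee_fin; apply: prodr_ge0 => i _.
by rewrite le_max lexx.
Qed.

Lemma lebesgue_outer_ge0 A : 0 <= lebesgue_outer A.
Proof.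
apply: le_ereal_inf_tmp => x [F _ <-].
by apply: nneseries_ge0 => k _ _; exact: box_volume_ge0.
Qed.

Lemma lebesgue_outer0 : lebesgue_outer set0 = 0.
Proof.
apply/eqP; rewrite eq_le lebesgue_outer_ge0 andbT.
apply: ereal_inf_lbound; exists (fun=> None) => //=.
by rewrite eseries0.
Qed.

Lemma le_lebesgue_outer :
  {homo lebesgue_outer : A B / (A `<=` B)%classic >-> A <= B}.
Proof.
move=> A B AB; apply/ereal_inf_le_tmp => x [F /= BF <-].
by exists F => //=; exact: subset_trans AB BF.
Qed.

Lemma lebesgue_outer_sigma_subadditive : sigma_subadditive lebesgue_outer.
Proof.
move=> A; have [[i ioo]|] := pselect (exists i, lebesgue_outer (A i) = +oo).
  rewrite (eseries_pinfty _ _ ioo) ?leey// => k _.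
  by rewrite -ltNye (lt_le_trans _ (lebesgue_outer_ge0 _)).
rewrite -forallNE => Aoo.
suff add2e (e : {posnum R}) : lebesgue_outer (\bigcup_n A n) <=
    \sum_(i <oo) lebesgue_outer (A i) + e%:num%:E.
  by apply/lee_addgt0Pr => _/posnumP[].
rewrite (le_trans _ (epsilon_trick _ _ _))//; last first.
  by move=> k; exact: lebesgue_outer_ge0.
pose P k (B : (option ('rV[R]_n * 'rV[R]_n))^nat) :=
  (A k `<=` \bigcup_j box (B j))%classic /\
  \sum_(j <oo) box_volume (B j) <=
    lebesgue_outer (A k) + (e%:num / (2 ^ k.+1)%:R)%:E.
have [G PG] : {G : ((option ('rV[R]_n * 'rV[R]_n))^nat)^nat &
    forall k, P k (G k)}.
  apply: (@choice _ _ P) => k; rewrite /P /lebesgue_outer.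
  set S := (X in ereal_inf X); move infS : (ereal_inf S) => iS.
  case: iS infS => [r Sr|Soo|Soo].
  - have en1 : (0 < e%:num / (2 ^ k.+1)%:R)%R by [].
    have /(lb_ereal_inf_adherent en1) : ereal_inf S \is a fin_num by rewrite Sr.
    move=> [x [B AnB muBx] xS].
    by exists B; split => //; rewrite muBx -Sr; exact/ltW.
  - by have := Aoo k; rewrite /lebesgue_outer -/S Soo.
  - have := lebesgue_outer_ge0 (A k).
    by rewrite /lebesgue_outer -/S Soo.
have muG_ge0 x : 0 <= (box_volume \o uncurry G) x by exact: box_volume_ge0.
apply: (@le_trans _ _ (\esum_(i in setT) (box_volume \o uncurry G) i)).
  apply: ereal_inf_lbound => /=.
  have /card_esym/ppcard_eqP[f] := card_nat2.
  exists (uncurry G \o f).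
    move=> t [i _ /(PG i).1 [j _ Bijt]].
    by exists (f^-1%FUN (i, j)) => //=; rewrite invK ?inE.
  rewrite -(esum_pred_image (box_volume \o uncurry G) _ xpredT) ?[fun=> _]set_true//.
  by rewrite image_eq.
rewrite (_ : esum _ _ = \sum_(i <oo) \sum_(j <oo) box_volume (G i j)); last first.
  pose J : nat -> set (nat * nat) := fun i => [set (i, j) | j in setT].
  rewrite (_ : setT = \bigcup_k J k); last first.
    by rewrite predeqE => -[a b]; split => // _; exists a => //; exists b.
  rewrite esum_bigcupT /=; last 2 first.
    - apply/trivIsetP => i j _ _ ij.
      rewrite predeqE => -[p m] /=; split => //= -[] [_] _ [<-{p} _].
      by move=> [m' _] [] /esym/eqP; rewrite (negbTE ij).
    - by move=> k; exact: muG_ge0.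
  rewrite -(image_id [set: nat]) -fun_true esum_pred_image//; last first.
    by move=> k _; apply: esum_ge0 => x _; exact: muG_ge0.
  apply: eq_eseriesr => /= j _.
  rewrite -(esum_pred_image (box_volume \o uncurry G) (pair j) predT)//=;
    [|by move=> k _; exact: box_volume_ge0
     |by move=> ? ? _ _; exact: (@can_inj _ _ _ snd)].
  by congr esum; rewrite predeqE => -[a b]; split; move=> [i _ <-]; exists i.
apply: lee_lim.
- apply: is_cvg_nneseries => k *.
  by apply: nneseries_ge0 => m *; exact: (muG_ge0 (k, m)).
- by apply: is_cvg_nneseries => k *; apply: adde_ge0 => //;
    exact: lebesgue_outer_ge0.
- by near=> k; apply: lee_sum => i _; exact: (PG i).2.
Unshelve. all: by end_near. Qed.

HB.instance Definition _ := isOuterMeasure.Build R _ lebesgue_outer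
  lebesgue_outer0 lebesgue_outer_ge0 le_lebesgue_outer
  lebesgue_outer_sigma_subadditive.

(* the Caratheodory sigma-algebra of the outer measure consists of the Lebesgue
   measurable sets; a Borel structure would not do, as a convex body need not be
   a Borel set *)
Definition lebesgue_Rn (A : set (caratheodory_type lebesgue_outer)) : \bar R :=
  lebesgue_outer A.

Let lebesgue_Rn0 : lebesgue_Rn set0 = 0.
Proof. exact: lebesgue_outer0. Qed.

Let lebesgue_Rn_ge0 A : 0 <= lebesgue_Rn A.
Proof. exact: lebesgue_outer_ge0. Qed.

Let lebesgue_Rn_semi_sigma_additive : semi_sigma_additive lebesgue_Rn.
Proof. exact: caratheodory_measure_sigma_additive. Qed.

HB.instance Definition _ := isMeasure.Build _ _ _ lebesgue_Rn
  lebesgue_Rn0 lebesgue_Rn_ge0 lebesgue_Rn_semi_sigma_additive.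

End lebesgue_measure_Rn.

(* [R[i]] as a normed space over itself, as the library does for the generic
   numeric fields in [numFieldNormedType] *)
#[non_forgetful_inheritance]
HB.instance Definition _ (R : rcfType) := PseudoPointedMetric.copy R[i] R[i]^o.
#[non_forgetful_inheritance]
HB.instance Definition _ (R : rcfType) := GRing.ComAlgebra.copy R[i] R[i]^o.
#[non_forgetful_inheritance]
HB.instance Definition _ (R : rcfType) := Vector.copy R[i] R[i]^o.
#[non_forgetful_inheritance]
HB.instance Definition _ (R : rcfType) := NormedModule.copy R[i] R[i]^o.

Section analysis_Cn.
Context (R : realType) (n : nat).
Implicit Types (r d : R) (f : 'rV[R[i]]_n -> R[i]).

(* the norm of the library on ['rV_n] is the maximum norm *)
Definition euclid_norm (x : 'rV[R]_n) : R := Num.sqrt (\sum_i x 0 i ^+ 2).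
Definition euclid_normC (z : 'rV[R[i]]_n) : R :=
  Num.sqrt (\sum_i Normc.normc (z 0 i) ^+ 2).

Definition Breal r : set 'rV[R]_n := [set x | euclid_norm x < r].
Definition Bcomplex r : set 'rV[R[i]]_n := [set z | euclid_normC z < r].

Definition to_Cn (x : 'rV[R]_n) : 'rV[R[i]]_n := map_mx (real_complex R) x.

(* complex (Frechet) differentiability; only the values of [f] on the ball
   matter *)
Definition holomorphic_on_ball r f :=
  forall z, Bcomplex r z -> differentiable f z.

Definition sup_abs T (A : set T) (g : T -> R[i]) : R :=
  sup [set Normc.normc (g x) | x in A].

Definition convex_body (V : set 'rV[R]_n) :=
  [/\ bounded_set V, convex_set (V : set (convex_lmodType 'rV[R]_n)) & V° !=set0].

(* the real line through [x] with direction [u]; for [u] of Euclidean norm 1 it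
   is an arc-length parametrization *)
Definition real_line (x u : 'rV[R[i]]_n) (t : R) : 'rV[R[i]]_n :=
  x + (real_complex R t) *: u.

Local Notation lambda := (@completed_lebesgue_measure R).

(* a null [omega] is excluded: the right-hand side is then infinite *)
Definition chebyshev_bound f d :=
  forall (x u : 'rV[R[i]]_n) (I omega : set R),
    Bcomplex 1 x -> euclid_normC u = 1 ->
    is_interval I -> (forall t, I t -> Bcomplex 1 (real_line x u t)) ->
    (wlength idfun)^*%mu.-cara.-measurable omega -> omega `<=` I ->
    (0 < lambda omega)%E ->
    sup_abs I (f \o real_line x u) <=
      (4 * fine (lambda I) / fine (lambda omega)) `^ d *
      sup_abs omega (f \o real_line x u).

(* the infimum of the empty set is [+oo] *)
Definition chebyshev_degree f : \bar R :=
  ereal_inf [set d%:E | d in [set d | 0 < d /\ chebyshev_bound f d]].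

End analysis_Cn.

(* Main.v *)
Require Import Defs.
From HB Require Import structures.
From mathcomp Require Import all_boot all_order all_algebra.
From mathcomp Require Import all_classical all_reals all_analysis.
From mathcomp Require Import complex measurable_realfun.
From mathcomp Require Import ring lra.

Import Order.TTheory GRing.Theory Num.Theory.
Import numFieldNormedType.Exports.

Local Open Scope classical_set_scope.
Local Open Scope ring_scope.

(** Write M for the supremum of |f| over V.  The proof bounds the measure of the
sublevel sets of |f| and then integrates in layers.

Fix a point x0 of V where |f| is almost maximal.  For every x in V the segment
from x0 to x lies in V, so the Chebyshev bound of exponent d on this segment says
that the parameters s of ]0, 1[ for which |f| is at most a at x0 + s (x - x0) form
a set of length at most 4 (a / |f x0|)^(1/d): a small sublevel set occupies a
small fraction of each segment issued from x0 ([ray_sublevel_bound]).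

This is turned into a bound on the n-dimensional measure of the sublevel set E
without polar coordinates.  By Tonelli, if every segment carries at most a
fraction delta of E, then the integral over s in ]0, 1[ of the measure of
{x in V | x0 + s (x - x0) in E} is at most delta |V|.  But for s close to 1 the
homothety of ratio s and centre x0 maps V onto almost all of V, because
|V| - s^n |V| <= n (1 - s) |V|; as soon as n (1 - s) |V| <= |E| / 2, the set of
these x has measure at least |E| / 2.  This range of s has length
|E| / (2 n |V|), whence |E|^2 <= 4 n delta |V|^2 ([starshaped_sublevel_bound]).
The square costs a factor 2 in the logarithm, which only affects the constant.

With the levels M 4^(-k d) and |f x0| > M 4^(-d), the k-th sublevel set has measure
at most 8 n 2^(-k) |V|.  The layer cake formula bounds the integral of
|log (|f| / M)| by d log 4 times the sum of these measures.  The roughly log2 n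
first terms are each bounded by |V| and the others form a convergent geometric
series, so that the sum is at most |V| times log2 n plus a constant: this is
where log n comes from. *)

Set Implicit Arguments.
Unset Strict Implicit.
Unset Printing Implicit Defensive.

(** * Lebesgue measure on R^n *)

Section measure_Rn.
Context (R : realType) (n : nat).
Local Notation vec := 'rV[R]_n.
Local Notation outer := (@lebesgue_outer R n).
Local Notation Rn := (caratheodory_type outer).

Lemma lebesgue_outer_cover (A : set vec) F :
  A `<=` \bigcup_k @box R n (F k) ->
  (outer A <= \sum_(k <oo) box_volume (F k))%E.
Proof. by move=> AF; apply: ereal_inf_lbound; exists F. Qed.

Definition set_coord (v : vec) (i : 'I_n) (c : R) : vec :=
  \row_j (if j == i then c else v 0 j).

(** The identity behind the measurability of half-spaces: a hyperplane cuts a box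
into two boxes whose volumes add up, also when the hyperplane misses the box or
when the box has an empty side. *)
Lemma box_volume_split (a b : vec) i c :
  (box_volume (Some (a, set_coord b i (Num.min (b 0 i) c)%R)) +
   box_volume (Some (set_coord a i (Num.max (a 0 i) c)%R, b)) =
   box_volume (Some (a, b)))%E.
Proof.
rewrite /= -EFinD; congr EFin.
rewrite (bigD1 i)//= [X in _ + X](bigD1 i)//= [RHS](bigD1 i)//= !mxE eqxx.
under eq_bigr do rewrite mxE ifN//.
under [in X in _ + X]eq_bigr do rewrite mxE ifN//.
rewrite -mulrDl; congr (_ * _).
rewrite !maxEle !minEle.
have [ba|ba] := leP (b 0 i - a 0 i) 0; have [?|?] := leP (b 0 i) c;
 have [?|?] := leP (a 0 i) c; rewrite /=; repeat case: ifPn;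
 rewrite -?ltNge => *; lra.
Qed.

(** Cutting every box of a cover of X by the hyperplane gives covers of both parts
of X, with the same total volume. *)
Lemma measurable_halfspace (i : 'I_n) (c : R) :
  measurable ([set x : vec | x 0 i < c] : set Rn).
Proof.
apply: le_caratheodory_measurable => X.
apply: le_ereal_inf_tmp => _ [F XF <-].
pose F1 k := if F k is Some (a, b)
  then Some (a, set_coord b i (Num.min (b 0 i) c)) else None.
pose F2 k := if F k is Some (a, b)
  then Some (set_coord a i (Num.max (a 0 i) c), b) else None.
have -> : (\sum_(k <oo) box_volume (F k) =
    \sum_(k <oo) box_volume (F1 k) + \sum_(k <oo) box_volume (F2 k))%E.
  rewrite -nneseriesD; try by move=> *; exact: box_volume_ge0.
  apply: eq_eseriesr => k _; rewrite /F1 /F2.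
  by case: (F k) => [[a b]|]; rewrite ?box_volume_split//= adde0.
apply: leeD; apply: lebesgue_outer_cover.
- move=> x [/XF[k _ Fkx] /ltW xc]; exists k => //; move: Fkx; rewrite /F1.
  case: (F k) => [[a b]|]//= abx j.
  have /andP[-> xb] := abx j; rewrite mxE; case: eqP => // ji.
  by rewrite le_min -{1}ji xb ji.
- move=> x [/XF[k _ Fkx] /negP]; rewrite -leNgt => xc.
  exists k => //; move: Fkx; rewrite /F2.
  case: (F k) => [[a b]|]//= abx j.
  have /andP[ax ->] := abx j; rewrite mxE; case: eqP => [ji|]; last by rewrite ax.
  by rewrite ge_max -{1}ji ax ji xc.
Qed.

Lemma measurable_coord (i : 'I_n) :
  measurable_fun [set: Rn] (fun x : Rn => (x : vec) 0 i).
Proof.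
apply: (measurability (@RGenCInfty.G R)) => [|/= _ [_] [r] -> <-].
  exact: RGenCInfty.measurableE.
rewrite setTI; have := measurableC (measurable_halfspace i r).
congr measurable; apply/seteqP; split => x /=; rewrite in_itv/= andbT.
  by move/negP; rewrite -leNgt.
by move=> rx; apply/negP; rewrite -leNgt.
Qed.

(** Second countability in a form fit for measurability: the boxes with rational
vertices that are contained in U exhaust it. *)
Lemma open_rational_boxes (U : set vec) : open U ->
  U = \bigcup_(pq : 'rV[rat]_n * 'rV[rat]_n)
        [set y : vec |
          (forall z : vec,
             (forall i, ratr (pq.1 0 i) < z 0 i < ratr (pq.2 0 i)) -> U z) /\
          forall i, ratr (pq.1 0 i) < y 0 i < ratr (pq.2 0 i)].
Proof.
move=> oU; apply/seteqP; split => [y Uy|y [pq _ [pqU /pqU//]]].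
have /nbhs_ballP[e /= e0 yeU] : nbhs y U by exact: open_nbhs_nbhs.
have lo i : exists q : rat, y 0 i - e < ratr q < y 0 i.
  have /rat_in_itvoo[q] : y 0 i - e < y 0 i by rewrite gtrBl.
  by rewrite in_itv/=; exists q.
have hi i : exists q : rat, y 0 i < ratr q < y 0 i + e.
  have /rat_in_itvoo[q] : y 0 i < y 0 i + e by rewrite ltrDl.
  by rewrite in_itv/=; exists q.
have [p pP] := choice lo; have [q qP] := choice hi.
exists (\row_i p i, \row_i q i) => //=; split => [z zpq|i]; last first.
  by rewrite !mxE; have /andP[_ ->] := pP i; have /andP[->] := qP i.
apply: yeU; split => // j i; rewrite !ord1 /ball/= /ball_ ltr_distl.
have := zpq i; rewrite !mxE.
have := pP i; have := qP i; lra.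
Qed.

(** Stated for an arbitrary source because it serves for R^n itself, for the line
and for the product of R^n with the line, where the map is a homothety with
varying ratio. *)
Lemma measurable_preimage_open d (T : measurableType d) (phi : T -> vec)
    (U : set vec) :
  (forall i, measurable_fun setT (fun t => phi t 0 i)) -> open U ->
  measurable (phi @^-1` U).
Proof.
move=> mphi /open_rational_boxes ->; rewrite preimage_bigcup.
apply: countable_bigcupT_measurable; first exact: countableP.
move=> [p q] /=.
have [H|H] := pselect (forall z : vec,
    (forall i, ratr (p 0 i) < z 0 i < ratr (q 0 i)) -> U z); last first.
  by rewrite (_ : _ @^-1` _ = set0)// -subset0 => x [].
rewrite (_ : _ @^-1` _ = \bigcap_(i in [set: 'I_n])
   ((fun t => phi t 0 i) @^-1` `]ratr (p 0 i), ratr (q 0 i)[%classic)).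
  apply: fin_bigcap_measurable => // i _.
  by rewrite -[X in measurable X]setTI; exact: mphi.
apply/seteqP; split => x /=.
  by move=> [_ xpq] i _ /=; rewrite in_itv/=.
by move=> xpq; split => // i; have := xpq i I; rewrite /= in_itv.
Qed.

Lemma open_measurable_Rn (U : set vec) : open U -> measurable (U : set Rn).
Proof. by move=> oU; exact: (measurable_preimage_open measurable_coord). Qed.

Lemma lebesgue_outer_box_lty (a b : vec) : (outer (box (Some (a, b))) < +oo)%E.
Proof.
pose F k := if k == 0%N then Some (a, b) else None : option (vec * vec).
apply: (@le_lt_trans _ _ (\sum_(k <oo) box_volume (F k))%E).
  by apply: lebesgue_outer_cover => x xab; exists 0%N.
rewrite (nneseries_split _ 1)//; last by move=> *; exact: box_volume_ge0.
rewrite eseries0; last by move=> [|i].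
by rewrite adde0 /= big_nat1 ltry.
Qed.

Lemma measurable_box B : measurable (box B : set Rn).
Proof.
case: B => [[a b]|]; last exact: measurable0.
rewrite (_ : box _ = \bigcap_(i in [set: 'I_n])
   ((fun x : Rn => (x : vec) 0 i) @^-1` `[a 0 i, b 0 i]%classic)).
  apply: fin_bigcap_measurable => // i _.
  by rewrite -[X in measurable X]setTI; exact: measurable_coord.
apply/seteqP; split => x /=.
  by move=> xpq i _ /=; rewrite in_itv/=.
by move=> xpq i; have := xpq i I; rewrite /= in_itv.
Qed.

Lemma bounded_box (V : set vec) : bounded_set V ->
  exists a b : vec, V `<=` box (Some (a, b)).
Proof.
move=> [M [_ MV]]; exists (const_mx (- (M + 1))), (const_mx (M + 1)) => x Vx i.
have := MV (M + 1) _ x Vx; rewrite ltrDl ltr01 => /(_ isT).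
rewrite !mxE -ler_norml; apply: le_trans.
rewrite [leRHS]/Num.Def.normr/= mx_normrE.
by apply/bigmax_geP; right; exists (0, i).
Qed.

Lemma sigma_finite_lebesgue_Rn : sigma_finite setT (@lebesgue_Rn R n).
Proof.
exists (fun k => box (Some (const_mx (- k%:R), const_mx k%:R))).
  apply/esym; rewrite -subTset => x _ /=.
  have [M M0 xM] : exists2 M : R, 0 <= M & forall i, `|x 0 i| <= M.
    exists (\sum_i `|x 0 i|); first by apply: sumr_ge0.
    by move=> i; rewrite (bigD1 i)//= lerDl sumr_ge0.
  exists (Num.bound M) => // i; rewrite !mxE -ler_norml.
  by rewrite (le_trans (xM i))// ltW// archi_boundP.
by move=> k; split; [exact: measurable_box|exact: lebesgue_outer_box_lty].
Qed.

HB.instance Definition _ :=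
  Measure_isSigmaFinite.Build _ _ _ (@lebesgue_Rn R n) sigma_finite_lebesgue_Rn.

Definition homothety (x0 : vec) (s : R) (x : vec) : vec := x0 + s *: (x - x0).

Lemma homothetyK x0 s : s != 0 ->
  cancel (homothety x0 s) (homothety x0 s^-1).
Proof.
move=> s0 x; rewrite /homothety [x0 + s *: _]addrC addrK scalerA mulVf//.
by rewrite scale1r addrC subrK.
Qed.

(** Homotheties map boxes to boxes; the reverse inequality is the same statement
for the inverse homothety. *)
Lemma lebesgue_outer_homothety (x0 : vec) s (A : set vec) : 0 < s ->
  (outer (homothety x0 s @` A) <= (s ^+ n)%:E * outer A)%E.
Proof.
move=> s0; rewrite -lee_pdivrMl ?exprn_gt0//.
apply: le_ereal_inf_tmp => _ [F AF <-].
rewrite lee_pdivrMl ?exprn_gt0//.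
pose G k := if F k is Some (a, b)
  then Some (homothety x0 s a, homothety x0 s b) else None.
rewrite -nneseriesZl; last by move=> *; exact: box_volume_ge0.
rewrite [leRHS](_ : _ = \sum_(k <oo) box_volume (G k))%E; last first.
  apply: eq_eseriesr => k _; rewrite /G; case: (F k) => [[a b]|]/=; last by rewrite mule0.
  rewrite -EFinM; congr EFin.
  rewrite -[X in s ^+ X](card_ord n) -prodr_const -big_split/=.
  apply: eq_bigr => i _; rewrite !mxE.
  rewrite maxr_pMr ?ltW// mulr0; congr Num.max; ring.
apply: lebesgue_outer_cover => _ [x /AF[k _ Fkx] <-]; exists k => //.
move: Fkx; rewrite /G; case: (F k) => [[a b]|]//= abx i.
have /andP[ax xb] := abx i.
by rewrite !mxE !lerD2l !ler_pM2l// !lerD2r ax xb.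
Qed.

End measure_Rn.

(** * Integrals without measurability, and Bernoulli's inequality *)

Section monotone_integral.
Local Open Scope ereal_scope.
Context d (T : measurableType d) (R : realType).
Variable mu : {measure set T -> \bar R}.

(** The integral of a nonnegative function is the supremum of the integrals of the
simple functions below it, so it is monotone for arbitrary functions. *)
Lemma ge0_le_integral_any (D : set T) (f g : T -> \bar R) :
  (forall x, D x -> 0 <= f x) -> (forall x, D x -> f x <= g x) ->
  \int[mu]_(x in D) f x <= \int[mu]_(x in D) g x.
Proof.
move=> f0 fg; have g0 x : D x -> 0 <= g x.
  by move=> Dx; exact: le_trans (f0 _ Dx) (fg _ Dx).
rewrite !ge0_integralE//; apply: ereal_sup_le => _ /= [h hf <-].
exists h => // x; apply: le_trans (hf x) _.
by rewrite /patch; case: ifPn => // /[!inE]; exact: fg.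
Qed.

Lemma integral_scaled_indic (k : R) (A : set T) : (0 <= k)%R -> measurable A ->
  \int[mu]_x (k%:E * (\1_A x)%:E) = k%:E * mu A.
Proof.
move=> k0 mA; rewrite ge0_integralZl_EFin//.
- by rewrite integral_indic// setIT.
- exact/measurable_EFinP/measurable_indic.
Qed.

End monotone_integral.

Lemma bernoulli_ineq (R : realDomainType) (e : R) n :
  0 <= e <= 1 -> 1 - n%:R * e <= (1 - e) ^+ n.
Proof.
move=> /andP[e0 e1]; elim: n => [|n ih]; first by rewrite mul0r subr0 expr0.
rewrite exprS; apply: le_trans (ler_wpM2l _ ih); last by rewrite subr_ge0.
rewrite -natr1; have : 0 <= n%:R * e * e by rewrite !mulr_ge0.
by lra.
Qed.

(** * Measurability of convex bodies *)

Section convex_sets.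
Context (R : realType) (n : nat).
Local Notation vec := 'rV[R]_n.
Local Notation outer := (@lebesgue_outer R n).
Local Notation Rn := (caratheodory_type outer).
Implicit Types V U : set vec.

Lemma convex_homothety V x0 x s :
  convex_set (V : set (convex_lmodType vec)) -> V x0 -> V x -> 0 <= s <= 1 ->
  V (homothety x0 s x).
Proof.
move=> cV Vx0 Vx /andP[s0 s1].
have := cV x x0 (Itv01 s0 s1); rewrite !inE => /(_ Vx Vx0).
congr (V _); rewrite -[LHS]/(s *: x + (1 - s) *: x0) /homothety.
by rewrite scalerBr scalerBl scale1r addrCA.
Qed.

(** If a ball around x1 lies in V, its convex hull with x contains a ball around
every point of the open segment from x1 to x. *)
Lemma homothety_interior V x1 x s :
  convex_set (V : set (convex_lmodType vec)) -> V° x1 -> V x -> 0 < s < 1 ->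
  V° (homothety x1 s x).
Proof.
move=> cV /nbhs_ballP[e /= e0 x1V] Vx /andP[s0 s1].
have s10 : 0 < 1 - s by rewrite subr_gt0.
apply/nbhs_ballP; exists ((1 - s) * e) => /=; first by rewrite mulr_gt0.
move=> y; rewrite -ball_normE/= => xy.
(* z is the point of the ball around x1 for which y = s x + (1 - s) z *)
pose z := x1 + (1 - s)^-1 *: (y - homothety x1 s x).
have Vz : V z.
  apply: x1V; rewrite -ball_normE/= /z opprD addrA subrr add0r normrN normrZ.
  by rewrite gtr0_norm ?invr_gt0// ltr_pdivrMl// distrC.
have := @convex_homothety V z x s cV Vz Vx; rewrite !ltW// => /(_ isT).
congr (V _); apply/rowP => i; rewrite /homothety /z !mxE.
by field; rewrite gt_eqF.
Qed.

Lemma lebesgue_outer0_measurable V : outer V = 0%E -> measurable (V : set Rn).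
Proof.
move=> V0; apply: le_caratheodory_measurable => X.
rewrite -[leRHS]add0e; apply: leeD; [rewrite -V0|];
  by apply: le_lebesgue_outer => x [].
Qed.

Lemma bounded_lebesgue_outer_fin V : bounded_set V -> outer V \is a fin_num.
Proof.
move=> /bounded_box[a [b Vab]]; rewrite ge0_fin_numE ?lebesgue_outer_ge0//.
exact: le_lt_trans (le_lebesgue_outer Vab) (lebesgue_outer_box_lty a b).
Qed.

(** The boundary part of V is null: a homothety of ratio s < 1 centred at an
interior point sends V into its interior, so the interior has measure at least
s^n |V|, for every s < 1. *)
Lemma convex_body_measurable V : convex_body V -> measurable (V : set Rn).
Proof.
move=> [bV cV [x1 Vx1]].
have VoV : V° `<=` V by exact: interior_subset.
have mVo : measurable (V° : set Rn).
  by apply: open_measurable_Rn; exact: open_interior.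
rewrite (_ : V = V° `|` (V `\` V°)); last by rewrite setDUK.
apply: measurableU => //; apply: lebesgue_outer0_measurable.
apply/eqP; rewrite eq_le lebesgue_outer_ge0 andbT.
have fV := bounded_lebesgue_outer_fin bV.
have fsub W : W `<=` V -> outer W \is a fin_num.
  move=> WV; rewrite ge0_fin_numE ?lebesgue_outer_ge0//.
  by apply: le_lt_trans (le_lebesgue_outer WV) _; rewrite -ge0_fin_numE ?lebesgue_outer_ge0.
have split : outer V = (outer V° + outer (V `\` V°))%E.
  rewrite (mVo V) setIidr// setDE//.
have fVo := fsub _ VoV.
have fD : outer (V `\` V°) \is a fin_num by apply: fsub; exact: subDsetl.
have shrink s : 0 < s < 1 -> ((s ^+ n)%:E * outer V <= outer V°)%E.
  move=> /andP[s0 s1].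
  have sn0 : 0 < s ^+ n by rewrite exprn_gt0.
  have : V `<=` homothety x1 s^-1 @` V°.
    move=> x Vx; exists (homothety x1 s x).
      by apply: homothety_interior => //; rewrite s0.
    by rewrite homothetyK// gt_eqF.
  move=> /le_lebesgue_outer/le_trans; rewrite -lee_pdivlMl//.
  by rewrite -exprVn; apply; apply: lebesgue_outer_homothety; rewrite invr_gt0.
move: split shrink; rewrite -(fineK fV) -(fineK fVo) -(fineK fD).
set v := fine _; set w := fine _; set u := fine _ => -[vwu] shrink.
have v0 : 0 <= v by apply: fine_ge0; exact: lebesgue_outer_ge0.
have u_le e : 0 < e < 1 -> u <= e * (n%:R * v).
  move=> /andP[e0 e1].
  have h1 : (1 - e) ^+ n * v <= w.
    by rewrite -lee_fin EFinM; apply: shrink; lra.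
  have h2 : (1 - n%:R * e) * v <= (1 - e) ^+ n * v.
    by apply: ler_wpM2r => //; apply: bernoulli_ineq; rewrite !ltW.
  by lra.
rewrite lee_fin leNgt; apply/negP => u0.
have nv0 : 0 <= n%:R * v by rewrite mulr_ge0.
(* a positive u would violate u <= e n v for this small e *)
pose e := Num.min (1 / 2) (u / (2 * (n%:R * v + 1))).
have e01 : 0 < e < 1.
  apply/andP; split; last by rewrite /e gt_min; apply/orP; left; lra.
  rewrite /e lt_min; apply/andP; split; first by lra.
  by rewrite divr_gt0// mulr_gt0//; lra.
have /= := u_le _ e01; apply/negP; rewrite -ltNge.
apply: (@le_lt_trans _ _ (u / (2 * (n%:R * v + 1)) * (n%:R * v))).
  by apply: ler_wpM2r => //; rewrite /e ge_min lexx orbT.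
rewrite mulrAC ltr_pdivrMr; last by lra.
by rewrite ltr_pM2l//; lra.
Qed.

End convex_sets.

(** * From a fraction of each segment to a fraction of the volume *)

Section starshaped_fraction.
Context (R : realType) (n : nat).
Local Notation vec := 'rV[R]_n.
Local Notation outer := (@lebesgue_outer R n).
Local Notation Rn := (caratheodory_type outer).
Local Notation mu := (@lebesgue_Rn R n).
Local Notation lambda := (@lebesgue_measure R).
Variables (V U : set vec) (x0 : vec) (delta : R).
Hypotheses (n0 : (0 < n)%N) (mV : measurable (V : set Rn)).
Hypotheses (fV : outer V \is a fin_num).
Hypotheses (cV : convex_set (V : set (convex_lmodType vec))) (Vx0 : V x0).
Hypotheses (oU : open U).
Hypothesis rays : forall x, V x ->
  (lambda [set s | 0 < s < 1 /\ ~ U (homothety x0 s x)]%R <= delta%:E)%E.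

Let E := V `\` U.
(* all pairs (x, s) for which the point at parameter s of the segment from x0 to x
   is in E; its sections are measured in both directions *)
Let A : set (Rn * measurableTypeR R) :=
  [set p | V p.1 /\ 0 < (p.2 : R) < 1 /\ ~ U (homothety x0 p.2 p.1)].

Let mE : measurable (E : set Rn).
Proof. by apply: measurableD => //; exact: open_measurable_Rn. Qed.

Let mA : measurable A.
Proof.
have -> : A = (V `*` `]0, 1[%classic) `&`
    ~` ((fun p : Rn * measurableTypeR R => homothety x0 p.2 p.1) @^-1` U).
  apply/seteqP; split=> -[x s] /=; rewrite in_itv/=.
    by move=> [? []].
  by move=> [[? ?] ?].
apply: measurableI; first exact: measurableX.
apply: measurableC; apply: measurable_preimage_open => // i.
rewrite (_ : (fun _ => _) = (fun p : Rn * measurableTypeR R =>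
   x0 0 i + p.2 * ((p.1 : vec) 0 i - x0 0 i))); last first.
  by apply/funext => p; rewrite /homothety !mxE.
apply: measurable_funD => //; apply: measurable_funM => //.
apply: measurable_funB => //.
exact: (measurableT_comp (measurable_coord i)).
Qed.

Let delta0 : 0 <= delta.
Proof. by have := le_trans (measure_ge0 lambda _) (rays Vx0); rewrite lee_fin. Qed.

Let subV_fin W : W `<=` V -> outer W \is a fin_num.
Proof.
move=> WV; rewrite ge0_fin_numE ?lebesgue_outer_ge0//.
by apply: le_lt_trans (le_lebesgue_outer WV) _; rewrite -ge0_fin_numE ?lebesgue_outer_ge0.
Qed.

Let v := fine (outer V).
Let e := fine (outer E).

Let EV : E `<=` V. Proof. exact: subDsetl. Qed.

Let outerVE : outer V = v%:E. Proof. by rewrite /v fineK. Qed.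
Let outerEE : outer E = e%:E. Proof. by rewrite /e fineK// subV_fin. Qed.

Let ev : e <= v.
Proof. by rewrite -lee_fin -outerVE -outerEE; exact: le_lebesgue_outer. Qed.

Let xsection_le x : (lambda (xsection A x) <= delta%:E * (\1_V x)%:E)%E.
Proof.
have [Vx|nVx] := pselect (V x); last first.
  rewrite (_ : xsection A x = set0) ?measure0; last first.
    by apply/seteqP; split => // s; rewrite /xsection/= inE => -[].
  by rewrite indicE memNset// mule0.
rewrite indicE mem_set// mule1; apply: le_trans (rays Vx).
apply: le_outer_measure => s; rewrite /xsection/= inE => -[_ []]; split => //.
Qed.

(* The homothety of ratio s maps the section onto the part of E that lies in the
   image of V, without increasing measures.  This image is contained in V and has
   measure s^n |V|, so it leaves out at most (1 - s^n) |V| <= n (1 - s) |V| of E. *)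
Let ysection_ge (s : R) : 0 < s < 1 ->
  ((e - n%:R * (1 - s) * v)%:E <= outer (ysection A s))%E.
Proof.
move=> s01; have /andP[s0 s1] := s01.
have sn0 : 0 < s ^+ n by rewrite exprn_gt0.
set B := ysection A s.
have BE : B = [set x | V x /\ ~ U (homothety x0 s x)].
  apply/seteqP; split => x; rewrite /B /ysection/= inE/=.
    by move=> [? []].
  by move=> [? ?]; split.
have BV : B `<=` V by rewrite BE => x [].
have VE : (outer (V `\` E) = (v - e)%:E)%E.
  have : (outer V = outer (V `&` E) + outer (V `&` ~` E))%E := mE V.
  rewrite setIidr// -setDE outerVE outerEE.
  have fVE : outer (V `\` E) \is a fin_num by apply: subV_fin => x [].
  rewrite -[outer (V `\` E)]fineK//.
  by move=> [->]; congr EFin; lra.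
have sVV : homothety x0 s @` V `<=` V.
  by move=> _ [x Vx <-]; apply: convex_homothety => //; rewrite !ltW.
have : ((s ^+ n * v)%:E <= outer (homothety x0 s @` V))%E.
  have : V `<=` homothety x0 s^-1 @` (homothety x0 s @` V).
    move=> x Vx; exists (homothety x0 s x); first by exists x.
    by rewrite homothetyK// gt_eqF.
  move=> /le_lebesgue_outer/le_trans; rewrite EFinM -outerVE -lee_pdivlMl//.
  by rewrite -exprVn; apply; apply: lebesgue_outer_homothety; rewrite invr_gt0.
rewrite [outer _](mE (homothety x0 s @` V)).
have h1 : (outer (homothety x0 s @` V `&` E) <= outer B)%E.
  apply: (@le_trans _ _ (outer (homothety x0 s @` B))).
    apply: le_lebesgue_outer => _ [[x Vx <-] [_ nU]]; exists x => //.
    by rewrite BE.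
  apply: le_trans (lebesgue_outer_homothety _ _ s0) _.
  rewrite -[leRHS]mul1e; apply: lee_wpmul2r; first exact: lebesgue_outer_ge0.
  by rewrite lee_fin exprn_ile1// ltW.
have h2 : (outer (homothety x0 s @` V `&` ~` E) <= (v - e)%:E)%E.
  by rewrite -VE; apply: le_lebesgue_outer => x [/sVV].
move=> /le_trans/(_ (leeD h1 h2)).
rewrite -[outer B]fineK ?subV_fin// -EFinD !lee_fin.
have := @bernoulli_ineq R (1 - s) n.
have -> : 0 <= 1 - s <= 1 by lra.
have v0 : 0 <= v by apply: fine_ge0; exact: lebesgue_outer_ge0.
have -> : 1 - (1 - s) = s by lra.
by move=> /(_ isT) /(ler_wpM2r v0); lra.
Qed.

(** Both iterated integrals of the indicator of A are compared: over s at fixed x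
the hypothesis gives delta, over x at fixed s close to 1 the section has measure
at least half of that of V \ U. *)
Lemma starshaped_sublevel_bound :
  fine (outer (V `\` U)) ^+ 2 <= 4 * n%:R * delta * fine (outer V) ^+ 2.
Proof.
rewrite -/E -/e -/v.
have [e0|e0] := leP e 0.
  have -> : e = 0.
    by apply/eqP; rewrite eq_le e0/=; apply: fine_ge0; exact: lebesgue_outer_ge0.
  rewrite expr0n/=; apply: mulr_ge0; last exact: sqr_ge0.
  by apply: mulr_ge0.
have v0 : 0 < v by exact: lt_le_trans ev.
have nr0 : 0 < n%:R :> R by rewrite ltr0n.
have nr1 : 1 <= n%:R :> R by rewrite ler1n.
have tonelli := indic_fubini_tonelli mu lambda mA.
rewrite indic_fubini_tonelli_FE// indic_fubini_tonelli_GE// in tonelli.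
(* for s in ]1 - w, 1[ the loss n (1 - s) v is at most e / 2 *)
pose w := e / (2 * n%:R * v).
have w0 : 0 < w by rewrite divr_gt0// !mulr_gt0.
have w1 : w <= 1 / 2.
  rewrite /w ler_pdivrMr ?mulr_gt0//.
  have : 1 * v <= n%:R * v by rewrite ler_pM2r.
  by have := ev; lra.
have wE : n%:R * w * v = e / 2.
  by rewrite /w; field; rewrite !gt_eqF.
have lhs : (\int[mu]_x (lambda \o xsection A) x <= (delta * v)%:E)%E.
  rewrite EFinM -outerVE -[outer V]/(mu V) -integral_scaled_indic//.
  apply: ge0_le_integral_any => x _ /=; first exact: measure_ge0.
  exact: xsection_le.
have rhs : ((e / 2 * w)%:E <= \int[lambda]_y (mu \o ysection A) y)%E.
  have -> : ((e / 2 * w)%:E = (e / 2)%:E * lambda `]((1 - w)%R : R), (1%R : R)[%classic)%E.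
    rewrite lebesgue_measure_itv/= lte_fin gtrBl w0 -EFinB -EFinM; congr EFin.
    lra.
  rewrite -integral_scaled_indic//; last by lra.
  apply: ge0_le_integral_any => // s _.
    by rewrite -EFinM lee_fin mulr_ge0//; lra.
  rewrite indicE; case: (boolP (s \in _)) => [|_]; last by rewrite mule0 lebesgue_outer_ge0.
  rewrite inE/= in_itv/= mule1 => /andP[ws s1].
  apply: le_trans (ysection_ge _); last by lra.
  rewrite lee_fin.
  have : n%:R * (1 - s) * v <= n%:R * w * v.
    by rewrite ler_pM2r// ler_pM2l//; lra.
  by rewrite wE; lra.
have : e / 2 * w <= delta * v.
  by rewrite -lee_fin; apply: le_trans rhs _; rewrite -tonelli.
have -> : e / 2 * w = e ^+ 2 / (4 * n%:R * v).
  by rewrite /w; field; rewrite !gt_eqF.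
rewrite ler_pdivrMr ?mulr_gt0//; lra.
Qed.

End starshaped_fraction.

(** * Restriction of f to real segments *)

(** Both sides are measures in A, so it is enough to compare them on intervals. *)
Lemma lebesgue_measure_dilation (R : realType) (c : R)
    (A : set (measurableTypeR R)) : 0 < c -> measurable A ->
  (lebesgue_measure A = c%:E * lebesgue_measure ((fun t : R => (c * t)%R) @^-1` A))%E.
Proof.
move=> c0; have c_ge0 : 0 <= c by exact: ltW.
pose g (t : measurableTypeR R) : measurableTypeR R := c * t.
have mg : measurable_fun setT g by exact: measurable_funM.
have [nu nuE] : exists nu : {measure set (measurableTypeR R) -> \bar R},
    forall B, nu B = (c%:E * lebesgue_measure (g @^-1` B))%E.
  unshelve (eexists (mscale (NngNum c_ge0)
      (pushforward (@lebesgue_measure R) g)));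
    [exact: mg|by []].
rewrite -nuE; apply: lebesgue_measure_unique => _ [[a b] _ <-]; rewrite nuE.
have -> : g @^-1` `]a, b] = `](c^-1 * a), (c^-1 * b)]%classic.
  apply/seteqP; split => t; rewrite /g/= !in_itv/=.
    by rewrite ltr_pdivrMl// ler_pdivlMl.
  by rewrite ltr_pdivrMl// ler_pdivlMl.
rewrite /= !lebesgue_measure_itv/= !lte_fin ltr_pM2l ?invr_gt0//.
case: ifP => _; last by rewrite mule0.
by rewrite -!EFinB -EFinM; congr EFin; field; rewrite gt_eqF.
Qed.

(** Continuity written with the coordinates of a row vector over an arbitrary
numeric field: with K left abstract the topology of the matrices is that of K,
and the conclusion only speaks of the norm. *)
Lemma differentiable_coord_ball (K : numFieldType) (n : nat) (W : normedModType K)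
    (f : 'rV[K]_n -> W) (z : 'rV[K]_n) : differentiable f z ->
  forall e : K, 0 < e -> exists2 r : K, 0 < r &
    forall y : 'rV[K]_n, (forall i, `|z 0 i - y 0 i| < r) -> `|f z - f y| < e.
Proof.
move=> /differentiable_continuous fz e e0.
have /nbhs_ballP[r /= r0 rf] := fz _ (nbhsx_ballx (f z) e e0).
exists r => // y zy; have /rf : ball z r y.
  by split => // i j; rewrite !ord1; exact: zy.
by rewrite -ball_normE.
Qed.

Section complex_embedding.
Context (R : realType) (n : nat).
Local Notation vec := 'rV[R]_n.
Implicit Types (x y : vec) (f : 'rV[R[i]]_n -> R[i]).

Lemma normc_real (a : R) : Normc.normc (real_complex R a) = `|a|.
Proof. by rewrite /= expr0n/= addr0 sqrtr_sqr. Qed.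

Lemma euclid_normC_to_Cn x : euclid_normC (to_Cn x) = euclid_norm x.
Proof.
congr Num.sqrt; apply: eq_bigr => i _.
by rewrite mxE normc_real real_normK ?num_real.
Qed.

Lemma euclid_normZ (a : R) x : euclid_norm (a *: x) = `|a| * euclid_norm x.
Proof.
rewrite /euclid_norm -sqrtr_sqr -sqrtrM ?sqr_ge0// mulr_sumr.
by congr Num.sqrt; apply: eq_bigr => i _; rewrite mxE exprMn.
Qed.

Lemma euclid_norm_gt0 x : x != 0 -> 0 < euclid_norm x.
Proof.
move=> /rV0Pn[i xi0]; rewrite sqrtr_gt0 (bigD1 i)//=.
by rewrite ltr_wpDr ?exprn_even_gt0// sumr_ge0// => j _; exact: sqr_ge0.
Qed.

Lemma real_line_to_Cn x u t :
  real_line (to_Cn x) (to_Cn u) t = to_Cn (x + t *: u).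
Proof. by apply/rowP => i; rewrite !mxE rmorphD rmorphM. Qed.

Lemma nbhs_abs_gt f x (a : R) : differentiable f (to_Cn x) ->
  a < Normc.normc (f (to_Cn x)) ->
  nbhs x [set y | a < Normc.normc (f (to_Cn y))].
Proof.
move=> /differentiable_coord_ball fx afx.
pose e := Normc.normc (f (to_Cn x)) - a.
have e0 : 0 < (e%:C)%C :> R[i] by rewrite ltcR subr_gt0.
have [rc rc0 rf] := fx _ e0.
pose r := complex.Re rc.
have rE : rc = (r%:C)%C.
  move: rc0; rewrite /r; case: (rc) => p q; rewrite ltcE/= => /andP[/eqP -> _].
  by [].
have r0 : 0 < r by move: rc0; rewrite rE ltcR.
apply/nbhs_ballP; exists r => //= y [_ xy].
have h i : `|to_Cn x 0 i - to_Cn y 0 i| < rc.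
  have := xy 0 i; rewrite /ball/= /ball_ !mxE -rmorphB => xyij.
  by rewrite rE -[X in X < _]/((Normc.normc _)%:C)%C normc_real ltcR.
have := rf _ h.
rewrite -[X in X < _]/((Normc.normc (f (to_Cn x) - f (to_Cn y)))%:C)%C ltcR /e.
have : Normc.normc (f (to_Cn x)) <=
    Normc.normc (f (to_Cn x) - f (to_Cn y)) + Normc.normc (f (to_Cn y)).
  by rewrite -{1}(subrK (f (to_Cn y)) (f (to_Cn x))); exact: le_normcD.
by rewrite /=; lra.
Qed.

End complex_embedding.

Section ray_estimate.
Context (R : realType) (n : nat).
Local Notation vec := 'rV[R]_n.
Local Notation lambda := (@lebesgue_measure R).

(** The Chebyshev bound on the segment from x0 to x.  There |f| reaches a value
above q^d a, and it is at most a on omega = V \ U.  So q^d < (4 L / |omega|)^d,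
where L is the length of the segment, that is |omega| / L < 4 / q.  Writing the
gap between the two levels as q^d avoids taking d-th roots. *)
Lemma ray_sublevel_bound (V U : set vec) (f : 'rV[R[i]]_n -> R[i])
    (M a q d : R) (x0 x : vec) :
  convex_set (V : set (convex_lmodType vec)) -> V `<=` Breal 1 ->
  (forall y, V y -> Normc.normc (f (to_Cn y)) <= M) ->
  open U -> (forall y, V y -> ~ U y -> Normc.normc (f (to_Cn y)) <= a) ->
  chebyshev_bound f d -> 0 < d -> 0 < a -> 1 <= q ->
  V x0 -> V x -> q `^ d * a < Normc.normc (f (to_Cn x0)) ->
  (lambda [set s | 0 < s < 1 /\ ~ U (homothety x0 s x)]%R <= (4 / q)%:E)%E.
Proof.
move=> cV V1 VM oU nUa cheb d0 a0 q1 Vx0 Vx fx0.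
have q0 : 0 < q by exact: lt_le_trans q1.
have qd1 : 1 <= q `^ d.
  have : 1 `^ d <= q `^ d by apply: ge0_ler_powR; rewrite ?nnegrE ?(ltW d0) ?(ltW q0).
  by rewrite powR1.
set S := [set s | _].
have [xx0|xx0] := eqVneq x x0.
  rewrite (_ : S = set0) ?measure0 ?lee_fin ?divr_ge0 ?ltW//.
  apply/seteqP; split => // s [_]; rewrite xx0 /homothety subrr scaler0 addr0.
  move=> /(nUa _ Vx0) fa; have : 1 * a <= q `^ d * a by rewrite ler_pM2r.
  by rewrite mul1r; lra.
set L := euclid_norm (x - x0).
have L0 : 0 < L by apply: euclid_norm_gt0; rewrite subr_eq0.
pose u : vec := L^-1 *: (x - x0).
have lineE t : real_line (to_Cn x0) (to_Cn u) t = to_Cn (homothety x0 (t / L) x).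
  by rewrite real_line_to_Cn /u scalerA.
(* S, with the parameter s in ]0, 1[ replaced by the arc length t = L s *)
pose om := [set t : R | 0 < t < L /\ ~ U (homothety x0 (t / L) x)].
have mom : measurable (om : set (measurableTypeR R)).
  have -> : om = `]0, L[%classic `&`
      ~` ((fun t : measurableTypeR R => homothety x0 (t / L) x) @^-1` U).
    by apply/seteqP; split => t /=; rewrite in_itv.
  apply: measurableI => //; apply: measurableC.
  apply: measurable_preimage_open => // i.
  rewrite (_ : (fun _ => _) = (fun t : measurableTypeR R =>
     x0 0 i + t * (L^-1 * (x 0 i - x0 0 i)))); last first.
    by apply/funext => t; rewrite /homothety !mxE mulrA.
  by apply: measurable_funD => //; exact: measurable_funM.
have lamom : lambda om = (L%:E * lambda S)%E.
  rewrite (lebesgue_measure_dilation L0 mom); congr (_ * lambda _)%E.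
  apply/seteqP; split => s /=; rewrite /om /S/=.
    by rewrite pmulr_rgt0// gtr_pMr// mulrAC divff ?gt_eqF// mul1r.
  by rewrite pmulr_rgt0// gtr_pMr// mulrAC divff ?gt_eqF// mul1r.
have omI : om `<=` `[0, L]%classic.
  by move=> t [/andP[t0 tL] _]; rewrite /= in_itv/= !ltW.
have lamI : lambda `[0, L]%classic = L%:E.
  by rewrite lebesgue_measure_itv/= lte_fin L0 sube0.
have Vline t : 0 <= t <= L -> V (homothety x0 (t / L) x).
  move=> /andP[t0 tL]; apply: convex_homothety => //.
  by rewrite divr_ge0 ?(ltW L0)//= ler_pdivrMr// mul1r.
have omfin : lambda om \is a fin_num.
  rewrite ge0_fin_numE//.
  have : (lambda om <= lambda `[0%R, L]%classic)%E by exact: le_outer_measure.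
  by move/le_lt_trans; apply; rewrite lamI ltry.
have Sfin : lambda S \is a fin_num.
  rewrite ge0_fin_numE//.
  have : S `<=` `]0, 1[%classic by move=> s [+ _]; rewrite /= in_itv.
  move=> S01; have : (lambda S <= lambda `]0%R, 1%R[%classic)%E.
    exact: le_outer_measure.
  by move/le_lt_trans; apply; rewrite lebesgue_measure_itv/= lte_fin ltr01 ltry.
rewrite -(fineK Sfin) lee_fin.
have [S0|S0] := leP (fine (lambda S)) 0.
  by apply: le_trans S0 _; rewrite divr_ge0// ltW.
have om0 : (0 < lambda om)%E by rewrite lamom -(fineK Sfin) -EFinM lte_fin mulr_gt0.
have /= := cheb (to_Cn x0) (to_Cn u) `[0, L]%classic om.
have -> : Bcomplex 1 (to_Cn x0) = True.
  by apply/propext; split=> // _; rewrite /Bcomplex/= euclid_normC_to_Cn; exact: V1.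
have -> : euclid_normC (to_Cn u) = 1.
  rewrite euclid_normC_to_Cn /u euclid_normZ ger0_norm ?invr_ge0 ?ltW//.
  by rewrite mulVf// gt_eqF.
move=> /(_ I erefl (@interval_is_interval _ _)).
have Bline t : `[0, L]%classic t -> Bcomplex 1 (real_line (to_Cn x0) (to_Cn u) t).
  rewrite /= in_itv/= => /Vline/V1.
  by rewrite lineE /Bcomplex/= euclid_normC_to_Cn.
move=> /(_ Bline (sub_caratheodory _ mom) omI om0) main.
have lower : Normc.normc (f (to_Cn x0)) <=
    sup_abs `[0, L]%classic (f \o real_line (to_Cn x0) (to_Cn u)).
  apply: ub_le_sup.
    exists M => _ [t /= + <-]; rewrite in_itv/= => /Vline/VM.
    by rewrite lineE.
  exists 0; first by rewrite /= in_itv/= lexx ltW.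
  by rewrite /= lineE mul0r /homothety scale0r addr0.
have upper : sup_abs om (f \o real_line (to_Cn x0) (to_Cn u)) <= a.
  have [[t omt]|/set0P/negP/negPn/eqP om_0] := pselect (om !=set0); last first.
    by move: om0; rewrite om_0 measure0 ltxx.
  apply: ge_sup; first by eexists; exists t.
  move=> _ [r [/andP[r0 rL] nU] <-] /=; rewrite lineE; apply: nUa => //.
  by apply: Vline; rewrite !ltW.
set w := 4 * _ / _ in main.
have wE : w = 4 / fine (lambda S).
  rewrite /w -[completed_lebesgue_measure _]/(lambda `[0, L]%classic).
  rewrite -[completed_lebesgue_measure _]/(lambda om) lamI lamom.
  rewrite fineM//=; field; rewrite !gt_eqF//.
have : q `^ d * a < w `^ d * a.
  apply: lt_le_trans fx0 _; apply: le_trans lower _; apply: le_trans main _.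
  by apply: ler_wpM2l => //; exact: powR_ge0.
rewrite ltr_pM2r// => qw.
have : q <= w.
  rewrite leNgt; apply/negP => wq; move: qw; apply/negP; rewrite -leNgt.
  by apply: ge0_ler_powR; rewrite ?nnegrE ?(ltW d0) ?(ltW q0) ?(ltW wq)// wE divr_ge0// ltW.
by rewrite wE ler_pdivlMr// ler_pdivlMr// mulrC.
Qed.

End ray_estimate.

(** * Summation over the levels *)

Section geometric_tail.
Context (R : realType).

(** The first K terms are at most 1 each; from there on n 2^(-K) <= 1 and the terms
are dominated by 8, 4, 2, ..., of sum 16. *)
Lemma sum_le_head_tail (e : nat -> R) (n K : nat) :
  (forall k, 0 <= e k) -> (forall k, e k <= 1) ->
  (forall k, e k <= 8 * n%:R * 2^-1 ^+ k) -> (n <= 2 ^ K)%N ->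
  forall N, \sum_(k < N) e k <= K%:R + 16.
Proof.
move=> e0 e1 en nK N.
have tail M : \sum_(k < K + M) e k <= K%:R + 16 - 16 * 2^-1 ^+ M.
  elim: M => [|M ih].
    rewrite addn0 expr0 mulr1 addrK.
    rewrite -[X in X%:R](card_ord K) -sumr_const; exact: ler_sum.
  rewrite addnS big_ord_recr/=.
  have : e (K + M)%N <= 8 * 2^-1 ^+ M.
    apply: le_trans (en _) _; rewrite exprD mulrA ler_wpM2r ?exprn_ge0//.
    rewrite -mulrA ler_piMr// exprVn ler_pdivrMr ?exprn_gt0// mul1r.
    by rewrite -natrX ler_nat.
  rewrite exprS; lra.
apply: (@le_trans _ _ (\sum_(k < K + N) e k)).
  rewrite addnC big_split_ord/= lerDl; exact: sumr_ge0.
apply: le_trans (tail N) _.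
by rewrite gerBl mulr_ge0// exprn_ge0.
Qed.

Lemma nneseries_le_bound (u : nat -> R) (B : R) : (forall k, 0 <= u k) ->
  (forall N, \sum_(k < N) u k <= B) -> (\sum_(k <oo) (u k)%:E <= B%:E)%E.
Proof.
move=> u0 uB; apply: lime_le.
  by apply: is_cvg_nneseries => k _ _; rewrite lee_fin.
by apply: nearW => N; rewrite sumEFin lee_fin big_mkord.
Qed.

(** A number t = - log rho >= 0 is at most c times the number of integers k with
k c <= t; when rho is 0, all k count and both sides are infinite. *)
Lemma lne_layer_cake (c rho : R) (E : nat -> bool) : 0 < c -> 0 <= rho <= 1 ->
  (forall k, rho <= expR (- (k%:R * c)) -> E k) ->
  (`| lne rho%:E | <= \sum_(k <oo) (c * (E k)%:R)%:E)%E.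
Proof.
move=> c0 /andP[rho0 rho1] rhoE.
set S := (\sum_(k <oo) _)%E.
have partial N : (forall k, (k < N)%N -> E k) -> ((N%:R * c)%:E <= S)%E.
  move=> EN; have <- : (\sum_(0 <= k < N) (c * (E k)%:R)%:E = (N%:R * c)%:E)%E.
    rewrite sumEFin big_mkord; congr EFin.
    rewrite (eq_bigr (fun=> c)); last by move=> k _; rewrite EN// mulr1.
    by rewrite sumr_const card_ord mulr_natl.
  apply: nneseries_lim_ge => k _ _; rewrite lee_fin mulr_ge0// ltW//.
have [rho_le|rho_gt] := leP rho 0.
  rewrite le0_lneNy ?lee_fin//=.
  have EN k : E k by apply: rhoE; rewrite (le_trans rho_le)// expR_ge0.
  have := partial (Num.bound (`|fine S| / c)) (fun k _ => EN k).
  case: S partial => [s|//|] partial; last first.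
    by have := partial 0%N (fun k _ => EN k).
  rewrite lee_fin/= => h; exfalso.
  have := @archi_boundP _ (`|s| / c); rewrite divr_ge0 ?(ltW c0)// => /(_ isT).
  by rewrite ltr_pdivrMr// => /lt_le_trans/(_ h); rewrite ltNge ler_norm.
rewrite lne_EFin// /abse ler0_norm ?ln_le0//.
set t := - ln rho.
have t0 : 0 <= t by rewrite oppr_ge0 ln_le0.
pose N := (Num.truncn (t / c)).+1.
apply: (@le_trans _ _ (N%:R * c)%:E).
  by rewrite lee_fin -ler_pdivrMr// ltW// truncnS_gt.
apply: partial => k; rewrite ltnS => kN; apply: rhoE.
rewrite -[leLHS]lnK ?posrE// ler_expR lerNr -/t -ler_pdivlMr//.
apply: (@le_trans _ _ (Num.truncn (t / c))%:R); first by rewrite ler_nat.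
by rewrite truncn_le divr_ge0// ltW.
Qed.

End geometric_tail.

(** * The mean of the logarithm *)

Section log_mean.
Context (R : realType) (n : nat) (V : set 'rV[R]_n) (f : 'rV[R[i]]_n -> R[i])
  (r d : R).
Local Notation vec := 'rV[R]_n.
Local Notation outer := (@lebesgue_outer R n).
Local Notation Rn := (caratheodory_type outer).
Local Notation mu := (@lebesgue_Rn R n).
Local Notation absf := (fun x : vec => Normc.normc (f (to_Cn x))).
Local Notation M := (sup_abs V (f \o @to_Cn R n)).
Hypotheses (n1 : (1 < n)%N) (r1 : 1 < r) (bodyV : convex_body V)
  (V1 : V `<=` Breal 1) (fr : holomorphic_on_ball r f) (M0 : M != 0)
  (d0 : 0 < d) (cheb : chebyshev_bound f d).

Let fV : outer V \is a fin_num.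
Proof. by case: bodyV => bV _ _; exact: bounded_lebesgue_outer_fin. Qed.

Let mV : measurable (V : set Rn).
Proof. exact: convex_body_measurable. Qed.

Let cV : convex_set (V : set (convex_lmodType vec)).
Proof. by case: bodyV. Qed.

(* the supremum of an unbounded set is 0 by convention, hence M0 gives boundedness *)
Let absf_has_sup : has_sup [set absf x | x in V].
Proof.
apply: contrapT => noSup; move/eqP: M0; apply; exact: sup_out.
Qed.

Let absf_le x : V x -> absf x <= M.
Proof. by move=> Vx; apply: sup_upper_bound => //; exists x. Qed.

Let normc_ge0 (z : R[i]) : 0 <= Normc.normc z.
Proof. by case: z => a b; exact: sqrtr_ge0. Qed.

Let M_gt0 : 0 < M.
Proof.
rewrite lt_neqAle eq_sym M0/=; case: absf_has_sup => -[_ [x Vx _]] _.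
exact: le_trans (absf_le Vx).
Qed.

Let v := fine (outer V).

Let level k : R := (4^-1 ^+ k) `^ d * M.

(* Only points of the ball are points of continuity of f, so the superlevel set is
   replaced by its interior, which has the same trace on V. *)
Let U k : set vec := [set x | level k < absf x]°.

Let E k : set vec := V `\` U k.

Let oU k : open (U k). Proof. exact: open_interior. Qed.

Let mE k : measurable (E k : set Rn).
Proof. by apply: measurableD => //; exact: open_measurable_Rn. Qed.

Let level_gt0 k : 0 < level k.
Proof. by rewrite mulr_gt0// powR_gt0// exprn_gt0. Qed.

Let notU_le k x : V x -> ~ U k x -> absf x <= level k.
Proof.
move=> Vx nU; rewrite leNgt; apply/negP => lt; apply: nU.
apply: nbhs_abs_gt => //; apply: fr; rewrite /Bcomplex/= euclid_normC_to_Cn.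
exact: lt_trans (V1 Vx) r1.
Qed.

Let fE k : outer (E k) \is a fin_num.
Proof.
rewrite ge0_fin_numE ?lebesgue_outer_ge0//.
apply: (@le_lt_trans _ _ (outer V)); last by rewrite -ge0_fin_numE ?lebesgue_outer_ge0.
by apply: le_lebesgue_outer => x [].
Qed.

Let E_le_v k : fine (outer (E k)) <= v.
Proof. by rewrite fine_le//; apply: le_lebesgue_outer => x []. Qed.

Let v_ge0 : 0 <= v. Proof. by apply: fine_ge0; exact: lebesgue_outer_ge0. Qed.

(* For k > 0, a point x0 of V with |f x0| > M 4^(-d) is above the level k by the
   factor q^d with q = 4^(k-1). *)
Let E_decay k : fine (outer (E k)) <= 8 * n%:R * 2^-1 ^+ k * v.
Proof.
have nr1 : 1 <= n%:R :> R by rewrite ler1n ltnW.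
case: k => [|k].
  apply: le_trans (E_le_v 0) _; rewrite expr0 mulr1 ler_peMl//; lra.
have small : 4^-1 `^ d < 1 :> R.
  have := @gt0_ltr_powR R d d0 4^-1 1; rewrite !nnegrE powR1; apply => //; lra.
have [_ [x0 Vx0 <-] fx0] : exists2 y, [set absf x | x in V] y & 4^-1 `^ d * M < y.
  apply: sup_gt; first by case: absf_has_sup.
  by rewrite -[X in _ < X]mul1r ltr_pM2r.
pose q : R := 4 ^+ k.
have q1 : 1 <= q by rewrite exprn_ege1//; lra.
have qlevel : q `^ d * level k.+1 = 4^-1 `^ d * M.
  rewrite /level mulrA -powRM ?(le_trans ler01 q1) ?exprn_ge0//.
  by congr (_ `^ _ * _); rewrite /q exprS mulrCA -exprMn divff ?expr1n ?mulr1.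
have rays x : V x ->
    (lebesgue_measure [set s | 0 < s < 1 /\ ~ U k.+1 (homothety x0 s x)]%R <=
     (4 / q)%:E)%E.
  move=> Vx; apply: (@ray_sublevel_bound R n V _ f M (level k.+1) q d) => //.
    exact: notU_le.
  by rewrite qlevel.
have := starshaped_sublevel_bound (ltnW n1) mV fV cV Vx0 (@oU k.+1) rays.
rewrite -/(E k.+1) -/v => sq.
rewrite -ler_sqr ?nnegrE ?fine_ge0 ?lebesgue_outer_ge0//; last first.
  by rewrite !mulr_ge0// exprn_ge0.
apply: le_trans sq _; rewrite !exprMn -exprM mulnC exprM.
have -> : (2^-1 ^+ 2) ^+ k.+1 = (4 * q)^-1 :> R.
  rewrite /q -exprS -exprVn; congr (_ ^+ _); lra.
rewrite ler_wpM2r ?sqr_ge0//.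
have qV : 0 < q^-1 by rewrite invr_gt0 (lt_le_trans _ q1).
rewrite invfM mulrA.
have : n%:R <= n%:R ^+ 2 :> R by rewrite expr2 ler_peMl.
move=> /(ler_wpM2r (ltW qV)); lra.
Qed.

Let c := d * ln 4.

Let ln4 : ln 4 = 2 * ln 2 :> R.
Proof.
have -> : 4 = 2 * 2 :> R by lra.
by rewrite lnM ?posrE//; lra.
Qed.

Let ln2_gt0 : 0 < ln 2 :> R. Proof. by rewrite ln_gt0//; lra. Qed.

Let c_gt0 : 0 < c. Proof. by rewrite mulr_gt0// ln4 mulr_gt0. Qed.

Let levelE k : level k = expR (- (k%:R * c)) * M.
Proof.
rewrite /level /powR gt_eqF ?exprn_gt0//; congr (expR _ * _).
rewrite lnXn ?invr_gt0// lnV ?posrE// /c -mulr_natl; lra.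
Qed.

Let pointwise x : V x ->
  (`| lne (absf x / M)%:E | <= \sum_(k <oo) (c * (\1_(E k) x))%:E)%E.
Proof.
move=> Vx; apply: lne_layer_cake => //.
  by rewrite divr_ge0 ?(ltW M_gt0)//= ler_pdivrMr// mul1r absf_le.
move=> k; rewrite ler_pdivrMr// -levelE => fk.
rewrite mem_set//; split => // /interior_subset/=.
by rewrite ltNge fk.
Qed.

Let measurable_indicE k : measurable_fun (V : set Rn) (\1_(E k) : Rn -> R).
Proof. exact: measurable_indic (mE k). Qed.

Let integral_le K : (n <= 2 ^ K)%N -> 0 < v ->
  (\int[mu]_(x in V) `| lne (absf x / M)%:E | <= (c * (K%:R + 16) * v)%:E)%E.
Proof.
move=> nK v0.
apply: (@le_trans _ _ (\int[mu]_(x in V) (\sum_(k <oo) (c * (\1_(E k) x))%:E))%E).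
  by apply: ge0_le_integral_any => x Vx; [exact: abse_ge0|exact: pointwise].
rewrite integral_nneseries; last 3 first.
- exact: mV.
- move=> k; apply/measurable_EFinP; apply: measurable_funM; last exact: measurable_indicE.
  exact: measurable_cst.
- by move=> k x _; rewrite lee_fin mulr_ge0// ltW.
rewrite (_ : (\sum_(k <oo) _)%E = (\sum_(k <oo) (c * fine (outer (E k)))%:E)%E); last first.
  apply: eq_eseriesr => k _.
  under eq_integral do rewrite EFinM.
  rewrite ge0_integralZl_EFin; last 4 first.
  - exact: mV.
  - by move=> x _; rewrite lee_fin.
  - by apply/measurable_EFinP; exact: measurable_indicE.
  - exact: ltW.
  rewrite integral_indic; last 2 first.
  - exact: mV.
  - exact: mE.
  rewrite (EFinM c) (fineK (fE k)) (_ : E k `&` V = E k)//.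
  by apply: setIidl => x [].
apply: nneseries_le_bound => [k|N].
  by rewrite mulr_ge0 ?(ltW c_gt0)// fine_ge0// lebesgue_outer_ge0.
rewrite -mulr_sumr -mulrA ler_wpM2l ?(ltW c_gt0)//.
rewrite -ler_pdivrMr// mulr_suml.
apply: (@sum_le_head_tail _ (fun k => fine (outer (E k)) / v) n K) => // k.
- by rewrite divr_ge0// fine_ge0// lebesgue_outer_ge0.
- by rewrite ler_pdivrMr// mul1r.
- by rewrite ler_pdivrMr.
Qed.

(** When V is null, the inverse of its measure is 0 by convention and so is the left
side.  Otherwise the sum over the levels is at most j + 17 with j the integer part of
log2 n, and d log 4 (j + 17) <= 36 d log n because j log 2 and log 2 are at most
log n. *)
Lemma log_mean_le :
  (v^-1%:E * \int[mu]_(x in V) `| lne (absf x / M)%:E | <=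
   (36 * ln n%:R * d)%:E)%E.
Proof.
have nr0 : 0 < n%:R :> R by rewrite ltr0n ltnW.
have lnn : ln 2 <= ln n%:R :> R by rewrite ler_ln ?posrE// ler_nat.
have [v0|v0] := leP v 0.
  have -> : v = 0 by apply/eqP; rewrite eq_le v0 v_ge0.
  rewrite invr0 mul0e lee_fin !mulr_ge0// ?(ltW d0)//.
  exact: le_trans (ltW ln2_gt0) lnn.
pose j := trunc_log 2 n.
have nj : (n <= 2 ^ j.+1)%N by rewrite ltnW// trunc_log_ltn.
have jn : j%:R * ln 2 <= ln n%:R :> R.
  rewrite mulr_natl -lnXn// ler_ln ?posrE ?exprn_gt0// -natrX ler_nat.
  by apply: trunc_logP => //; exact: ltnW.
rewrite lee_pdivrMl//; apply: le_trans (integral_le nj v0) _.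
rewrite -EFinM lee_fin mulrC ler_wpM2l//.
rewrite /c ln4 -natr1.
have : (j%:R + 17) * ln 2 <= 18 * ln n%:R :> R by rewrite mulrDl; lra.
by move=> /(ler_wpM2r (ltW d0)); lra.
Qed.

End log_mean.

Theorem corollary1p10 (R : realType) :
  exists C : R, forall (n : nat) (r : R) (V : set 'rV[R]_n)
      (f : 'rV[R[i]]_n -> R[i]),
    (1 < n)%N -> 1 < r ->
    convex_body V -> V `<=` Breal 1 ->
    holomorphic_on_ball r f ->
    sup_abs V (f \o @to_Cn R n) != 0 ->
    ((fine (@lebesgue_Rn R n V))^-1%:E *
       \int[@lebesgue_Rn R n]_(x in V)
         `| lne (Normc.normc (f (to_Cn x)) /
                 sup_abs V (f \o @to_Cn R n))%:E |
     <= C%:E * chebyshev_degree f * (ln n%:R)%:E)%E.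
Proof.
exists 36 => n r V f n1 r1 bodyV V1 fr M0.
have lnn : 0 < 36 * ln n%:R :> R by rewrite mulr_gt0// ln_gt0// ltr1n.
rewrite [leRHS]muleAC -EFinM -lee_pdivrMl//.
(* the Chebyshev degree is an infimum, so each admissible exponent d is treated *)
apply: le_ereal_inf_tmp => _ [d [d0 cheb] <-].
by rewrite lee_pdivrMl// -EFinM; exact: (log_mean_le n1 r1 bodyV V1 fr M0 d0 cheb).
Qed.
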